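(* Let $\ell\in\mathbb{N}\cup\{0\}$ and let $R_\ell(m,N)$ be the number of generalized Rogers--Ramanujan partitions of $N$ (associated with $\ell$) with rank $m$. Then, as formal power series, \[ \sum_{N=0}^{\infty}\sum_{m=-\infty}^{\infty}R_\ell(m,N)z^mq^N=\sum_{n=0}^{\infty}\frac{z^{n+\ell-1}q^{n^2+\ell n}}{(zq;q)_n}. \]
   Context: A generalized Rogers--Ramanujan partition of $N$ associated with $\ell$ is a partition of $N$ into parts all greater than $\ell$ in which any two parts differ by at least $2$. The rank of a partition is its largest part minus its number of parts; the identity corresponds to the convention that the empty partition contributes $z^{\ell-1}$ (i.e. is assigned rank $\ell-1$). Notation: $(a;q)_0=1$, $(a;q)_n=\prod_{k=0}^{n-1}(1-aq^k)$. *)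

(* Defs.v *)
From HB Require Import structures.
From mathcomp Require Import all_boot all_order all_algebra finmap.
From mathcomp Require Import boolp classical_sets functions cardinality fsbigop.

Set Implicit Arguments.
Unset Strict Implicit.
Unset Printing Implicit Defensive.
Import Order.TTheory GRing.Theory Num.Theory.
Local Open Scope classical_set_scope.
Local Open Scope ring_scope.

(* A[[q]], for a commutative ring A, with the Cauchy product. *)
Record fps (A : Type) := Fps { fcoef : nat -> A }.

Section FormalPowerSeries.
Variable A : comNzRingType.
Implicit Types f g h : fps A.

HB.instance Definition _ := [isNew for @fcoef A].
HB.instance Definition _ := [Choice of fps A by <:].

Lemma fpsP f g : fcoef f =1 fcoef g <-> f = g.
Proof.
by split=> [|-> //]; case: f g => f [g] /= /funext ->.
Qed.

Definition fps_const (a : A) : fps A := Fps (fun n => if n == 0%N then a else 0).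
Definition fps_var : fps A := Fps (fun n => (n == 1%N)%:R).
Definition fps_opp f := Fps (fun n => - fcoef f n).
Definition fps_add f g := Fps (fun n => fcoef f n + fcoef g n).
Definition fps_mul f g :=
  Fps (fun n => \sum_(i < n.+1) fcoef f i * fcoef g (n - i)).

Fact fps_addA : associative fps_add.
Proof. by move=> f g h; apply/fpsP => n /=; rewrite addrA. Qed.
Fact fps_addC : commutative fps_add.
Proof. by move=> f g; apply/fpsP => n /=; rewrite addrC. Qed.
Fact fps_add0 : left_id (fps_const 0) fps_add.
Proof. by move=> f; apply/fpsP => n /=; rewrite if_same add0r. Qed.
Fact fps_addN : left_inverse (fps_const 0) fps_opp fps_add.
Proof. by move=> f; apply/fpsP => n /=; rewrite addNr if_same. Qed.

HB.instance Definition _ :=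
  GRing.isZmodule.Build (fps A) fps_addA fps_addC fps_add0 fps_addN.

Fact fcoef_mul_rev f g n :
  fcoef (fps_mul f g) n = \sum_(i < n.+1) fcoef f (n - i) * fcoef g i.
Proof.
rewrite /= (reindex_inj rev_ord_inj) /=.
by apply: eq_bigr => i _; rewrite (sub_ordK i).
Qed.

Fact fps_mulA : associative fps_mul.
Proof.
move=> f g h; apply/fpsP => n.
pose c j k := fcoef f j * (fcoef g (n - j - k) * fcoef h k).
transitivity (\sum_(j < n.+1) \sum_(k < n.+1 | (k <= n - j)%N) c j k).
  apply: eq_bigr => j _; rewrite fcoef_mul_rev big_distrr /=.
  by rewrite (big_ord_narrow_leq (leq_subr _ _)).
rewrite fcoef_mul_rev (exchange_big_dep predT) //=; apply: eq_bigr => k _.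
transitivity (\sum_(j < n.+1 | (j <= n - k)%N) c j k).
  apply: eq_bigl => j; rewrite -ltnS -(ltnS j) -!subSn ?leq_ord //.
  by rewrite -subn_gt0 -(subn_gt0 j) -!subnDA addnC.
rewrite (big_ord_narrow_leq (leq_subr _ _)) big_distrl /=.
by apply: eq_bigr => j _; rewrite /c -!subnDA addnC mulrA.
Qed.

Fact fps_mulC : commutative fps_mul.
Proof.
move=> f g; apply/fpsP => n; rewrite fcoef_mul_rev /=.
by apply: eq_bigr => i _; rewrite mulrC.
Qed.

Fact fps_mul1 : left_id (fps_const 1) fps_mul.
Proof.
move=> f; apply/fpsP => n /=; rewrite big_ord_recl subn0 mul1r.
by rewrite big1 ?addr0 // => i _; rewrite /= mul0r.
Qed.

Fact fps_mulDl : left_distributive fps_mul +%R.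
Proof.
move=> f g h; apply/fpsP => n /=; rewrite -big_split.
by apply: eq_bigr => i _; rewrite /= mulrDl.
Qed.

Fact fps1_neq0 : fps_const 1 != 0.
Proof. by apply/eqP => /fpsP/(_ 0%N)/eqP /=; rewrite oner_eq0. Qed.

HB.instance Definition _ := GRing.Zmodule_isComNzRing.Build (fps A)
  fps_mulA fps_mulC fps_mul1 fps_mulDl fps1_neq0.

(* f^-1 is the unique inverse of f when there is one, and f itself otherwise. *)
Definition fps_unit : pred (fps A) := fun f => `[< exists g, g * f = 1 >].
Definition fps_inv f : fps A := xget f [set g | g * f = 1].

Fact fps_mulV : {in fps_unit, left_inverse 1 fps_inv *%R}.
Proof.
move=> f /asboolP [g gf]; rewrite /fps_inv.
by case: xgetP => [_ _ //|/(_ g)].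
Qed.

Fact fps_unitP f g : g * f = 1 -> fps_unit f.
Proof. by move=> gf; apply/asboolP; exists g. Qed.

Fact fps_inv_out : {in [predC fps_unit], fps_inv =1 id}.
Proof.
move=> f; rewrite inE => /asboolPn nf; rewrite /fps_inv.
by case: xgetP => // g _ gf; case: nf; exists g.
Qed.

HB.instance Definition _ := GRing.ComNzRing_hasMulInverse.Build (fps A)
  fps_mulV fps_unitP fps_inv_out.

(* The sum of a family that converges in the q-adic topology: for each N, only
   finitely many u n have a nonzero coefficient of q^N. *)
Definition fps_sum (u : nat -> fps A) : fps A :=
  Fps (fun N => \sum_(n \in [set: nat]) fcoef (u n) N).

End FormalPowerSeries.

Definition qpoch (B : comNzRingType) (a q : B) (n : nat) : B :=
  \prod_(k < n) (1 - a * q ^+ k).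

(* The coefficients in q are Laurent polynomials in z; the field Q(z) contains
   Z[z, z^-1], and the powers z^m, m : int, are linearly independent in it. *)
Definition Qz : fieldType := {fraction {poly int}}.
Definition z : fps Qz := fps_const (tofrac 'X).
Definition q : fps Qz := fps_var Qz.

(* Partitions are listed in weakly decreasing order. *)
Definition is_partition (N : nat) (s : seq nat) : bool :=
  [&& sorted geq s, all (ltn 0) s & sumn s == N].

Definition is_RR_partition (l N : nat) (s : seq nat) : bool :=
  [&& is_partition N s, all (ltn l) s & pairwise (fun a b => 2 <= a - b)%N s].

Definition rank (l : nat) (s : seq nat) : int :=
  if s is [::] then l%:Z - 1 else (\max_(a <- s) a)%:Z - (size s)%:Z.

Lemma finite_partitions (N : nat) : finite_set [set s | is_partition N s].
Proof.
pose T := {k : 'I_N.+1 & k.-tuple 'I_N.+1}.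
pose F (t : T) : seq nat := map val (tagged t).
apply: (@sub_finite_set _ _ (F @` [set: T])); last first.
  by apply: finite_image; apply: finite_finset.
move=> s /= /and3P[_ s_gt0 /eqP sN].
have szs : (size s <= N)%N.
  rewrite -sN; elim: s s_gt0 {sN} => //= a s IH /andP[a0 /IH].
  by move=> h; rewrite -add1n leq_add.
have sle a : a \in s -> (a <= N)%N.
  by rewrite -sN; elim: s {s_gt0 sN szs} => //= b s IH; rewrite inE
    => /orP[/eqP-> | /IH h]; [exact: leq_addr | exact: leq_trans h (leq_addl _ _)].
have szt : size (map (@inord N) s) == Ordinal (szs : (size s < N.+1)%N).
  by rewrite size_map.
exists (Tagged (fun k : 'I_N.+1 => k.-tuple 'I_N.+1) (Tuple szt)) => //.
rewrite /F /= -map_comp -[RHS]map_id; apply/eq_in_map => a /sle aN.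
by rewrite /= inordK.
Qed.

Definition R (l : nat) (m : int) (N : nat) : nat :=
  #|` fset_set [set s | is_RR_partition l N s /\ rank l s = m]|.

(* Main.v *)
Require Import Defs.
From HB Require Import structures.
From mathcomp Require Import all_boot all_order all_algebra finmap.
From mathcomp Require Import boolp classical_sets functions cardinality fsbigop.
From mathcomp Require Import zify.
Import GRing.Theory.
Local Open Scope classical_set_scope.
Local Open Scope ring_scope.

(* Let G_{l,n} be the generating function, with z marking rank and q marking
   size, of the generalized Rogers-Ramanujan partitions with n parts, and split
   those with n + 1 parts by whether l + 1 is a part.  If it is not,
   subtracting 1 from every part loses 1 in rank and n + 1 in size; if it is,
   deleting it leaves n parts all greater than l + 2 and gains 1 in rank, also
   for n = 0 by the convention on the rank of the empty partition.  Hence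
     (1 - z q^{n+1}) G_{l,n+1} = z^{-1} q^{l+1} G_{l+2,n},
   so that G_{l,n} is the n-th summand of the right-hand side, by induction. *)

(** [J] may be infinite, but only the finitely many values of [h] on [A] have nonempty fibers. Used
    below with [rank] and with [size] as [h]. *)
Lemma fsbig_fibers (T J : choiceType) (V : nmodType) (h : T -> J) (A : set T)
    (F : T -> V) : finite_set A ->
  \sum_(j \in [set: J]) \sum_(s \in A `&` h @^-1` [set j]) F s
  = \sum_(s \in A) F s.
Proof.
move=> finA; rewrite (@fsbigTE _ _ _ _ [fset h s | s in fset_set A]%fset) => [|j].
  rewrite (fsbig_finite _ _ finA) [RHS](partition_big_imfset _ h).
  apply: eq_bigr => j _; rewrite fsbig_mkcondr (fsbig_finite _ _ finA).
  rewrite [RHS]big_mkcond; apply: eq_bigr => s _.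
  by rewrite (_ : (s \in h @^-1` [set j]) = (h s == j)) //; apply/asboolP/eqP.
move=> jA; apply: fsbig1 => s [As /= hs]; case/negP: jA.
by apply/imfsetP; exists s; rewrite //= in_fset_set // inE.
Qed.

(** * Coefficients and units of formal power series *)

Section FpsCoefficients.
Variable A : comNzRingType.
Implicit Types (a b : A) (f g : fps A).

Lemma fcoef_sum (I : Type) (r : seq I) (F : I -> fps A) N :
  fcoef (\sum_(i <- r) F i) N = \sum_(i <- r) fcoef (F i) N.
Proof.
elim: r => [|i r IH]; first by rewrite !big_nil /= if_same.
by rewrite !big_cons /= IH.
Qed.

Lemma fcoef_constM a f N : fcoef (fps_const a * f) N = a * fcoef f N.
Proof.
rewrite /= big_ord_recl subn0 big1 ?addr0 // => i _.
by rewrite /= mul0r.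
Qed.

Lemma fcoef_varM f N :
  fcoef (fps_var A * f) N = if N is N'.+1 then fcoef f N' else 0.
Proof.
case: N => [|N] /=; first by rewrite big_ord_recl big_ord0 mul0r addr0.
rewrite 2!big_ord_recl /= mul0r add0r mul1r subSS subn0 big1 ?addr0 // => i _.
by rewrite mul0r.
Qed.

Lemma fcoef_varXM k f N :
  fcoef (fps_var A ^+ k * f) N = if (k <= N)%N then fcoef f (N - k) else 0.
Proof.
elim: k N => [|k IH] N; first by rewrite expr0 mul1r leq0n subn0.
by rewrite exprS -mulrA fcoef_varM; case: N => [|N] //; rewrite IH.
Qed.

Lemma fcoef_constXn a k N :
  fcoef (fps_const a * fps_var A ^+ k) N = if N == k then a else 0.
Proof.
rewrite fcoef_constM -[_ ^+ k]mulr1 fcoef_varXM /= subn_eq0 eqn_leq.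
case: (k <= N)%N => /=; rewrite ?andbT ?andbF ?mulr0 //.
by case: ifP; rewrite ?mulr1 ?mulr0.
Qed.

Lemma fps_const_is_additive : {morph @fps_const A : a b / a - b}.
Proof. by move=> a b; apply/fpsP => -[|n] //=; rewrite subr0. Qed.

Lemma fps_const_is_monoid_morphism : monoid_morphism (@fps_const A).
Proof.
split=> // a b; apply/fpsP => n.
by rewrite fcoef_constM /= (fun_if ( *%R a)) mulr0.
Qed.

HB.instance Definition _ := GRing.isZmodMorphism.Build A (fps A)
  (@fps_const A) fps_const_is_additive.
HB.instance Definition _ := GRing.isMonoidMorphism.Build A (fps A)
  (@fps_const A) fps_const_is_monoid_morphism.

(** The inverse is the geometric series [g]: for [N >= k.+1] its coefficient at [N] is [a] times the
    one at [N - k.+1]. *)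
Lemma fps_unit_1BconstXn a k :
  1 - fps_const a * fps_var A ^+ k.+1 \is a GRing.unit.
Proof.
pose g : fps A := Fps (fun N => if (k.+1 %| N)%N then a ^+ (N %/ k.+1) else 0).
suff gP : g * (1 - fps_const a * fps_var A ^+ k.+1) = 1 by exact: fps_unitP gP.
apply/fpsP => N; rewrite mulrC mulrBl mul1r -mulrA.
transitivity (fcoef g N - fcoef (fps_const a * (fps_var A ^+ k.+1 * g)) N) => //.
rewrite fcoef_constM fcoef_varXM.
case: (leqP k.+1 N) => [kN|Nk]; last first; rewrite ?kN.
  rewrite mulr0 subr0 /=; case: N Nk => [|N] Nk; first by rewrite dvdn0 div0n.
  by rewrite gtnNdvd.
rewrite -{1}(subnK kN) /= dvdn_addl // divnDr // divnn addn1.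
case: ifP => _; rewrite -?exprS ?mulr0 subrr; by case: (N) kN.
Qed.

End FpsCoefficients.

(** * Partitions with a fixed number of parts *)

Definition RR_parts (l n N : nat) : set (seq nat) :=
  [set s | is_RR_partition l N s /\ size s = n].

(** Subtraction is truncated, so a gap of at least 2 already forces the list to decrease; parts
    above [l] are positive. *)
Lemma is_RR_partitionE l N s :
  is_RR_partition l N s = [&& all (ltn l) s,
    pairwise (fun a b => 2 <= a - b)%N s & sumn s == N].
Proof.
rewrite /is_RR_partition /is_partition.
have [s_gt /=|//] := boolP (all (ltn l) s); last by rewrite !andbF.
have [s_gap /=|] := boolP (pairwise _ s); last by rewrite !andbF.
rewrite andbT (sub_all _ s_gt) => [|a /=]; last exact: leq_ltn_trans.
rewrite (_ : sorted _ _) //; apply: pairwise_sorted.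
by apply: sub_pairwise s_gap => a b /=; lia.
Qed.

Lemma finite_RR l N : finite_set [set s | is_RR_partition l N s].
Proof.
apply: sub_finite_set (finite_partitions N) => s /=.
by rewrite /is_RR_partition => /andP[].
Qed.

Lemma finite_RR_parts l n N : finite_set (RR_parts l n N).
Proof. by apply: sub_finite_set (finite_RR l N) => s -[]. Qed.

(** The sizes are constrained by additions, so nothing is truncated: an image is empty when [N] is
    below its shift. *)
Lemma RR_parts_split l n N :
  RR_parts l n.+1 N =
    (map succn @`
      [set s | RR_parts l n.+1 (sumn s) s /\ (sumn s + n.+1)%N = N])
    `|` (rcons^~ l.+1 @`
      [set s | RR_parts l.+2 n (sumn s) s /\ (sumn s + l.+1)%N = N]).
Proof.
have gapS s : pairwise (fun a b => 2 <= a - b)%N (map succn s) =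
              pairwise (fun a b => 2 <= a - b)%N s by rewrite pairwise_map.
have sumS s : sumn (map succn s) = (sumn s + size s)%N.
  by elim: s => //= a s ->; lia.
apply/seteqP; split=> [s [] | s [[t [[+ tn] <-] <-] | [t [[+ tn] <-] <-]]].
- rewrite is_RR_partitionE; case/lastP: s => // t x.
  rewrite all_rcons pairwise_rcons sumn_rcons size_rcons => /and3P[].
  move=> /andP[lx tl] /andP[tx tgap] /eqP sumN [tn].
  (* The last part [x] is the smallest. If it is [l.+1], the gaps put the others above [l.+2];
     otherwise all parts exceed [l.+1] and can be lowered by 1. *)
  move: lx; rewrite /= leq_eqVlt => /orP[/eqP lx|lx].
    subst x; right; exists t => //; split=> //; split=> //.
    rewrite is_RR_partitionE tgap eqxx /= andbT.
    by apply: sub_all tx => a /=; lia.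
  left; set s := rcons t x.
  have s_gt : all (ltn l.+1) s.
    by rewrite all_rcons /= lx; apply: sub_all tx => a /=; lia.
  have predS : map succn (map predn s) = s.
    rewrite -map_comp -[RHS]map_id; apply/eq_in_map => a /(allP s_gt) /=; lia.
  have ssz : size (map predn s) = n.+1 by rewrite size_map size_rcons tn.
  exists (map predn s) => //; split; last first.
    by rewrite -ssz -sumS predS /s sumn_rcons.
  split=> //; rewrite is_RR_partitionE eqxx andbT -gapS predS.
  rewrite /s pairwise_rcons tx tgap /= andbT all_map.
  by apply: sub_all s_gt => a /=; lia.
- rewrite is_RR_partitionE => /and3P[tl tgap _].
  split; last by rewrite size_map.
  rewrite is_RR_partitionE gapS tgap sumS tn eqxx !andbT all_map.
  by apply: sub_all tl => a /=; lia.
- rewrite is_RR_partitionE => /and3P[tl tgap _].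
  split; last by rewrite size_rcons tn.
  rewrite is_RR_partitionE all_rcons pairwise_rcons tgap sumn_rcons /= eqxx ltnSn.
  by rewrite !andbT /=; apply/andP; split; apply: sub_all tl => a /=; lia.
Qed.

(** Lists of the second kind contain [l.+1]; in a list of the first kind it would come from a part
    equal to [l]. *)
Lemma RR_parts_split_disjoint l n (A B : set nat) :
  (map succn @` [set s | RR_parts l n.+1 (sumn s) s /\ A (sumn s)])
    `&` (rcons^~ l.+1 @` [set s | RR_parts l.+2 n (sumn s) s /\ B (sumn s)])
  `<=` set0.
Proof.
move=> _ [[s [[+ _] _] <-] [t _ /(congr1 (fun u => l.+1 \in u))]].
rewrite is_RR_partitionE mem_rcons mem_head => /andP[/allP sl _].
by move/esym/mapP => [a /sl /= la [al]]; rewrite al ltnn in la.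
Qed.

(** * Effect of the two moves on the rank *)

Lemma bigmax_succn s :
  s != [::] -> \max_(a <- map succn s) a = (\max_(a <- s) a).+1.
Proof.
elim: s => // a [|b s] IH _; first by rewrite /= !big_seq1.
by rewrite [in RHS]big_cons -maxnSS -IH // [LHS]big_cons.
Qed.

Lemma rank_map_succn l s : s != [::] -> rank l (map succn s) = 1 + rank l s.
Proof.
case: s => // a s s0; rewrite /rank (bigmax_succn _ s0) /= size_map; lia.
Qed.

Lemma rank_rcons l s : all (ltn l.+2) s ->
  rank l (rcons s l.+1) = -1 + rank l.+2 s.
Proof.
move=> sl; rewrite /rank; case: s sl => [|a s] sl.
  (* By convention the empty list has rank [l + 1] for [l.+2], one more than the rank [l] of
     [[:: l.+1]]. *)
  by rewrite /= big_seq1; lia.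
have maxE : \max_(b <- a :: rcons s l.+1) b = \max_(b <- a :: s) b.
  rewrite -rcons_cons -cats1 big_cat big_seq1; apply/maxn_idPl.
  by case/andP: sl => la _; rewrite big_cons leq_max (ltnW (ltnW la)).
by rewrite rcons_cons maxE /= size_rcons; lia.
Qed.

(** * Generating functions by number of parts *)

Definition Z : Qz := tofrac 'X.

Lemma Z_unit : Z \is a GRing.unit.
Proof. by rewrite unitfE tofrac_eq0 polyX_eq0. Qed.

Lemma z_exprz (m : int) : z ^ m = fps_const (Z ^ m).
Proof. by rewrite (rmorphXz (@fps_const Qz) _ Z_unit). Qed.

Lemma z_unit : z \is a GRing.unit.
Proof. exact: (rmorph_unit (@fps_const Qz) Z_unit). Qed.

Definition RR_gf (l n : nat) : fps Qz :=
  Fps (fun N => \sum_(s \in RR_parts l n N) Z ^ rank l s).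

Lemma RR_gf0 l : RR_gf l 0 = z ^ (l%:Z - 1).
Proof.
apply/fpsP => N; rewrite z_exprz /=.
have [->|N0] := eqVneq N 0%N.
  rewrite (_ : RR_parts l 0 0 = [set [::]]) ?fsbig_set1 //.
  by apply/seteqP; split=> s /= => [[_ /size0nil] | ->].
rewrite fsbig1 // => s [] /[swap] /size0nil ->.
by rewrite is_RR_partitionE /= => /eqP N0'; rewrite -N0' in N0.
Qed.

(** The summands come from the partitions without and with the part [l.+1]. The first involves the
    same series again; moving it to the left gives the factor [1 - z * q ^+ n.+1] of [RR_gfS]. *)
Lemma RR_gfS_sum l n N :
  fcoef (RR_gf l n.+1) N =
    fcoef (fps_const Z * (q ^+ n.+1 * RR_gf l n.+1)) N
    + fcoef (fps_const Z^-1 * (q ^+ l.+1 * RR_gf l.+2 n)) N.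
Proof.
have fin k m c : finite_set
    [set s | RR_parts k m (sumn s) s /\ (sumn s + c)%N = N].
  apply: (@sub_finite_set _ _ (RR_parts k m (N - c))) => [s [+ sN]|].
    by rewrite -sN addnK.
  exact: finite_RR_parts.
(* If [c] exceeds [N], the right-hand sum is over an empty set. *)
have coef k m c : (if (c <= N)%N then fcoef (RR_gf k m) (N - c) else 0)
    = \sum_(s \in [set s | RR_parts k m (sumn s) s /\ (sumn s + c)%N = N])
        Z ^ rank k s.
  case: leqP => cN; last first.
    by rewrite fsbig1 // => s [_ sN]; move: cN; rewrite -sN; lia.
  apply: eq_fsbigl; apply/seteqP; split=> s /=.
    rewrite /RR_parts /= !is_RR_partitionE.
    by move=> [/and3P[-> -> /eqP->] ->]; rewrite eqxx subnK.
  by move=> [sRR <-]; rewrite addnK.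
rewrite !fcoef_constM !fcoef_varXM !coef /= RR_parts_split.
rewrite (@fsbigU0 _ _ _ _ (map succn @` _)) //.
- congr (_ + _).
    rewrite fsbig_image; last by move=> s t _ _; apply: inj_map; apply: succn_inj.
    rewrite mulr_fsumr; apply: eq_fsbigr => s; rewrite inE => -[[_ sn] _].
    by rewrite rank_map_succn -?size_eq0 ?sn // (exprzDr Z_unit).
  rewrite fsbig_image; last by move=> s t _ _ /rcons_inj[].
  rewrite mulr_fsumr; apply: eq_fsbigr => s; rewrite inE => -[[+ _] _].
  rewrite is_RR_partitionE => /andP[sl _]; rewrite rank_rcons //.
  by rewrite (exprzDr Z_unit) exprN1.
- exact: finite_image.
- exact: finite_image.
- exact: (@RR_parts_split_disjoint l n
    [set k | (k + n.+1)%N = N] [set k | (k + l.+1)%N = N]).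
Qed.

Lemma RR_gfS l n :
  (1 - z * q ^+ n.+1) * RR_gf l n.+1 = z^-1 * q ^+ l.+1 * RR_gf l.+2 n.
Proof.
rewrite mulrBl mul1r; apply/eqP; rewrite subr_eq; apply/eqP.
rewrite -[z^-1]/(z ^ (-1)) z_exprz exprN1 -!mulrA addrC.
by apply/fpsP => N; rewrite RR_gfS_sum.
Qed.

Lemma qpoch_unit n : qpoch (z * q) q n \is a GRing.unit.
Proof.
rewrite /qpoch; apply: rpred_prod => k _.
by rewrite -mulrA -exprS fps_unit_1BconstXn.
Qed.

Lemma RR_gfE l n :
  RR_gf l n = z ^ (n%:Z + l%:Z - 1) * q ^+ (n ^ 2 + l * n)%N / qpoch (z * q) q n.
Proof.
apply: (mulIr (qpoch_unit n)); rewrite divrK ?qpoch_unit //.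
(* [l] stays general because the recurrence passes to [l.+2]. *)
elim: n l => [|n IH] l.
  by rewrite RR_gf0 /qpoch big_ord0 mulr1 muln0 expr0 mulr1 add0r.
rewrite /qpoch big_ord_recr /= -mulrA -exprS mulrC -mulrA RR_gfS.
rewrite mulrCA [_ * RR_gf _ _]mulrC IH.
rewrite mulrACA -exprD -[z^-1]/(z ^ (-1)) -(exprzDr z_unit).
(* For [q]: [(l + 1) + n^2 + (l + 2) n = (n + 1)^2 + l (n + 1)]. *)
congr (z ^ _ * q ^+ _); lia.
Qed.

Theorem theorem4p1 (l : nat) :
  fps_sum (fun N : nat => \sum_(m \in [set: int]) (R l m N)%:R * z ^ m * q ^+ N)
  = fps_sum (fun n : nat =>
      z ^ (n%:Z + l%:Z - 1) * q ^+ (n ^ 2 + l * n)%N / qpoch (z * q) q n).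
Proof.
(* Each [R l m N] is the size of a fiber of the rank, on which [z ^ rank l s] is constantly
   [z ^ m]. *)
have termE N : \sum_(m \in [set: int]) (R l m N)%:R * z ^ m * q ^+ N =
    \sum_(s \in [set s | is_RR_partition l N s]) z ^ rank l s * q ^+ N.
  rewrite -(@fsbig_fibers _ _ _ (rank l)); last exact: finite_RR.
  apply: eq_fsbigr => m _.
  have fin : finite_set ([set s | is_RR_partition l N s] `&` rank l @^-1` [set m]).
    by apply: sub_finite_set (finite_RR l N) => s [].
  rewrite (fsbig_finite _ _ fin) (eq_big_seq (fun=> z ^ m * q ^+ N)) => [|s].
    by rewrite big_const_seq count_predT iter_addr_0 -mulrA mulr_natl.
  by rewrite in_fset_set // inE => -[_ /= ->].
apply/fpsP => N.
have sumE (u : nat -> fps Qz) :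
  fcoef (fps_sum u) N = \sum_(n \in [set: nat]) fcoef (u n) N by [].
(* On the left only the term of index [N] contributes to [q ^+ N]. *)
rewrite !sumE (@fsbigTE _ _ _ _ [fset N]%fset) => [|k].
  rewrite big_seq_fset1 termE (fsbig_finite _ _ (finite_RR l N)) fcoef_sum.
  rewrite (eq_bigr (fun s => Z ^ rank l s)) => [|s _]; last first.
    by rewrite z_exprz fcoef_constXn eqxx.
  rewrite -(fsbig_finite _ _ (finite_RR l N)).
  (* Grouping by number of parts yields the coefficients of the series [RR_gf l n]. *)
  rewrite -(@fsbig_fibers _ _ _ size); last exact: finite_RR.
  by apply: eq_fsbigr => n _; rewrite -RR_gfE.
rewrite inE => kN; rewrite termE (fsbig_finite _ _ (finite_RR l k)) fcoef_sum.
by rewrite big1 // => s _; rewrite z_exprz fcoef_constXn eq_sym (negPf kN).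
Qed.
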